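(* Let $\pi:(X,f_{1,\infty})\to(Y,g_{1,\infty})$ be a strong semiconjugacy between non-autonomous discrete dynamical systems. If $(X,f_{1,\infty})$ is extended transitive or strongly extended transitive, then $(Y,g_{1,\infty})$ satisfies the corresponding property.
   Context: $\mathbb{N}=\{1,2,3,\dots\}$. A non-autonomous discrete dynamical system (NDDS) is a pair $(X,f_{1,\infty})$ where $X$ is a compact metric space and $f_{1,\infty}=(f_n)_{n\in\mathbb{N}}$ is a sequence of continuous maps $f_n:X\to X$. A strong semiconjugacy $\pi:(X,f_{1,\infty})\to(Y,g_{1,\infty})$ is a continuous surjection $\pi:X\to Y$ with $\pi\circ f_n=g_n\circ\pi$ for each $n\in\mathbb{N}$. $\Sigma=\{(n_1,\dots,n_p): p\in\mathbb{N},\ n_i\in\mathbb{N}\}$ is the set of finite (nonempty) words over $\mathbb{N}$, and for $\alpha=(n_1,\dots,n_p)\in\Sigma$, $f_\alpha:=f_{n_p}\circ\cdots\circ f_{n_1}$. An NDDS $(X,f_{1,\infty})$ is extended transitive if $\bigcup_{\alpha\in\Sigma}f_\alpha(V)$ is dense in $X$ for every nonempty open $V\subset X$, and strongly extended transitive if $\bigcup_{\alpha\in\Sigma}f_\alpha(V)=X$ for every nonempty open $V\subset X$. *)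

(* Defs.v *)
From mathcomp Require Import all_boot all_order all_algebra.
From mathcomp Require Import all_classical all_reals topology.

Set Implicit Arguments.
Unset Strict Implicit.
Unset Printing Implicit Defensive.

Local Open Scope classical_set_scope.

(* The maps are indexed from 0: [ndds_map S n] is f_(n+1), so that the type
   [nat] of indices stands for {1, 2, 3, ...}. *)
Record ndds (R : realType) := NDDS {
  ndds_space :> metricType R;
  ndds_compact : compact [set: ndds_space];
  ndds_map : nat -> ndds_space -> ndds_space;
  ndds_continuous : forall n, continuous (ndds_map n) }.

Arguments ndds_map {R} S n x : rename.

Definition strong_semiconjugacy (R : realType) (S T : ndds R) (p : S -> T) :
    Prop :=
  [/\ continuous p,
      set_surj [set: S] [set: T] p &
      forall n, p \o ndds_map S n = ndds_map T n \o p].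

Definition words : set (seq nat) := [set a | a <> [::]].

(* For a = [:: n_1; ...; n_p], the map f_(n_p) \o ... \o f_(n_1): the head of
   the word is applied first. *)
Definition word_map (R : realType) (S : ndds R) (a : seq nat) (x : S) : S :=
  foldl (fun y n => ndds_map S n y) x a.

Definition word_orbit (R : realType) (S : ndds R) (V : set S) : set S :=
  \bigcup_(a in words) (word_map a @` V).

Definition extended_transitive (R : realType) (S : ndds R) : Prop :=
  forall V : set S, open V -> V !=set0 -> dense (word_orbit V).

Definition strongly_extended_transitive (R : realType) (S : ndds R) : Prop :=
  forall V : set S, open V -> V !=set0 -> word_orbit V = [set: S].

(* Main.v *)
Require Import Defs.
From mathcomp Require Import all_boot all_order all_algebra.
From mathcomp Require Import all_classical all_reals topology.

(** Open sets are pulled back along [p]: the preimage of a nonempty open [V] is open by continuity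
    and nonempty by surjectivity, so transitivity of [X] applies to it. Since [p] intertwines every
    word map, it carries the orbit of the preimage into the orbit of [V]
    ([semiconjugacy_word_orbit]); this single inclusion transfers both properties to [Y]. *)

Lemma semiconjugacy_word_map (R : realType) (X Y : ndds R) (p : X -> Y)
    (hp : strong_semiconjugacy p) (a : seq nat) (x : X) :
  p (word_map a x) = word_map a (p x).
Proof.
case: hp => _ _ pf.
(* The point [x] stays general: the head letter acts first, so the induction hypothesis is used at
   [ndds_map X n x]. *)
elim: a x => [//|n a IHa] x.
have pfn : p (ndds_map X n x) = ndds_map Y n (p x).
  exact: (congr1 (fun h => h x) (pf n)).
by rewrite /word_map /= -pfn; exact: IHa.
Qed.

Lemma semiconjugacy_word_orbit (R : realType) (X Y : ndds R) (p : X -> Y)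
    (hp : strong_semiconjugacy p) (V : set Y) (x : X) :
  word_orbit (p @^-1` V)%classic x -> word_orbit V (p x).
Proof.
move=> [a aw [z Vz <-]]; exists a => //; exists (p z) => //.
by rewrite -semiconjugacy_word_map.
Qed.

Lemma semiconjugacy_preimage_neq0 (R : realType) (X Y : ndds R) (p : X -> Y)
    (hp : strong_semiconjugacy p) (V : set Y) :
  (V !=set0)%classic -> (p @^-1` V !=set0)%classic.
Proof.
case: hp => _ ps _ [y Vy]; have [x _ pxy] := ps y I.
by exists x; rewrite /preimage /= pxy.
Qed.

Lemma semiconjugacy_open_preimage (R : realType) (X Y : ndds R) (p : X -> Y)
    (hp : strong_semiconjugacy p) (V : set Y) :
  open V -> open (p @^-1` V)%classic.
Proof. by case: hp => /continuousP pc _ _; exact: pc. Qed.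

Theorem theorem3p13 (R : realType) (X Y : ndds R) (p : X -> Y)
    (hp : strong_semiconjugacy p) :
  (extended_transitive X -> extended_transitive Y) /\
  (strongly_extended_transitive X -> strongly_extended_transitive Y).
Proof.
have pV0 := semiconjugacy_preimage_neq0 _ _ _ _ hp.
have pVo := semiconjugacy_open_preimage _ _ _ _ hp.
split=> tX V Vo V0; have := tX _ (pVo _ Vo) (pV0 _ V0).
  (* Density in [X] is tested on the preimage of [O]; the image under [p] of the point found lies in
     [O] and in the orbit of [V]. *)
  move=> dX O O0 Oo; have [x [Ox orbx]] := dX _ (pV0 _ O0) (pVo _ Oo).
  by exists (p x); split=> //; exact: semiconjugacy_word_orbit.
move=> orbX; apply/seteqP; split=> // y _.
(* Any lift [x] of [y] will do, as the orbit of the preimage of [V] is all of [X]. *)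
case: (hp) => _ ps _; have [x _ <-] := ps y I.
by apply: semiconjugacy_word_orbit => //; rewrite orbX.
Qed.
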